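(* Fix $\lambda>0$ and $t\in[0,T)$. Then the policy iteration scheme $(V^{n,n})_{n\ge0}$ for the Bermudan game converges almost surely, in the sense that $$V^{n,n}_t=V^\lambda_t\quad\text{almost surely, for all } n\ge N(t+),$$ where $N(t+)=(N+1)-\max\{i:\ t_i\le t\}$.
   Context: Setting. $(\Omega,\mathcal F,\mathbb P,\mathbb F)$ is a filtered probability space whose filtration $\mathbb F=(\mathcal F_t)_{t\ge0}$ satisfies the usual conditions; martingales are càdlàg. $T>0$, $S=\{t_0,t_1,\dots,t_N\}$ with $0=t_0<t_1<\dots<t_N<T$, and $t_{N+1}:=T$. $X_{t+}$ denotes the right limit of a process $X$ at $t$. $P$ and $R$ are $\mathbb F$-adapted processes, $P\ge0$, with $R>P$ on $S$, $R_T=P_T$, $\max_{u\in S\cup\{T\}}\mathbb E[P_u]<\infty$ and $\max_{u\in S\cup\{T\}}\mathbb E[R_u]<\infty$. Entropy-regularised game value. For $x\ne0$, $\Psi(x)=\frac1x\ln\big(\frac{e^x-1}{x}\big)$, $\Psi(0)=\frac12$, $\Phi(x)=x\Psi(x)$. $(V^\lambda,M^\lambda)$ is the unique pair ($V^\lambda$ of class (D), $M^\lambda$ a uniformly integrable martingale started at $0$) solving $V^\lambda_t=P_T-(M^\lambda_T-M^\lambda_t)+\sum_{t\le t_i<T}\{\lambda\Phi(\lambda^{-1}(P_{t_i}-V^\lambda_{t_i+}))-\lambda\Phi(\lambda^{-1}(V^\lambda_{t_i+}-R_{t_i}))\}$, $t\in[0,T]$. Policy iteration scheme. $\Pi$ is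 the set of families $\pi=(\pi_{t_i})_{i=0,\dots,N}$ of random probability densities on $[0,1]$, with $\pi_{t_i}(u)$ being $\mathcal B([0,1])\otimes\mathcal F_{t_i}$-measurable. Define $$G(t_i,x,\pi_{t_i})=\int_0^1\{(P_{t_i}-x)u\,\pi_{t_i}(u)-\lambda\pi_{t_i}(u)\ln\pi_{t_i}(u)\}du,\quad H(t_i,x,\pi_{t_i})=\int_0^1\{(x-R_{t_i})u\,\pi_{t_i}(u)-\lambda\pi_{t_i}(u)\ln\pi_{t_i}(u)\}du,$$ with maximisers over densities $$\underline\pi^*_{t_i}(x,u)=\frac{a}{e^a-1}e^{au},\ a=\tfrac1\lambda(P_{t_i}-x),\qquad\overline\pi^*_{t_i}(x,u)=\frac{b}{e^b-1}e^{bu},\ b=\tfrac1\lambda(x-R_{t_i})$$ (uniform density when $a=0$, resp. $b=0$). Start from $V^{0,0}_t=\mathbb E[P_T|\mathcal F_t]$ and initial policies $\underline\pi^0,\overline\pi^0\in\Pi$. For $n\ge0$: (1) $\overline\pi^{n+1}_{t_i}(u)=\overline\pi^*_{t_i}(V^{n,n}_{t_i+},u)$; (2) $V^{n,n+1}_t=P_T-(M^{n,n+1}_T-M^{n,n+1}_t)+\sum_{t\le t_i<T}\{G(t_i,V^{n,n}_{t_i+},\underline\pi^n_{t_i})-H(t_i,V^{n,n+1}_{t_i+},\overline\pi^{n+1}_{t_i})\}$; (3) $\underline\pi^{n+1}_{t_i}(u)=\underline\pi^*_{t_i}(V^{n,n+1}_{t_i+},u)$; (4) $V^{n+1,n+1}_t=P_T-(M^{n+1,n+1}_T-M^{n+1,n+1}_t)+\sum_{t\le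 t_i<T}\{G(t_i,V^{n+1,n+1}_{t_i+},\underline\pi^{n+1}_{t_i})-H(t_i,V^{n,n+1}_{t_i+},\overline\pi^{n+1}_{t_i})\}$; where in (2) and (4) the unknowns are the value process (of class (D)) and the uniformly integrable martingale started at $0$. *)

(* Defs.v *)
From HB Require Import structures.
From mathcomp Require Import all_boot all_order all_algebra.
From mathcomp Require Import all_classical all_reals all_analysis.
Import Order.TTheory GRing.Theory Num.Theory.
Import numFieldNormedType.Exports.

Set Implicit Arguments.
Unset Strict Implicit.
Unset Printing Implicit Defensive.

Local Open Scope classical_set_scope.
Local Open Scope ring_scope.

(* Processes are functions [X : R -> Omega -> R] of which only the values at
   times in [0, T] (for the filtration: in [0, +oo[) matter.  "Almost surely"
   is [{ae Pr, _}]: the complement of the event is [Pr]-negligible. *)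

Section Processes.
Context {d : measure_display} {Omega : measurableType d} {R : realType}.
Variables (Pr : probability Omega R) (F : R -> set (set Omega)) (T : R).
Implicit Types (X M : R -> Omega -> R).

Record filtration_usual : Prop := FiltrationUsual {
  filtration_sigma : forall t, 0 <= t -> sigma_algebra setT (F t);
  filtration_sub : forall t, 0 <= t -> F t `<=` measurable;
  filtration_mono : forall s t, 0 <= s -> s <= t -> F s `<=` F t;
  filtration_rc : forall t, 0 <= t ->
    F t = \bigcap_(s in [set s | t < s]) F s;
  (* with [filtration_sub], this also says that [Pr] is complete *)
  filtration_null : forall A, Pr.-negligible A -> F 0 A }.

Definition measurable_wrt (G : set (set Omega)) (Y : Omega -> R) : Prop :=
  forall B : set R, measurable B -> G (Y @^-1` B).

Definition adapted X : Prop :=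
  forall t, 0 <= t <= T -> measurable_wrt (F t) (X t).

Definition is_condexp (G : set (set Omega)) (Z Y : Omega -> R) : Prop :=
  [/\ measurable_wrt G Y,
      Pr.-integrable setT (EFin \o Y)
    & forall A, G A ->
        (\int[Pr]_(w in A) (Y w)%:E = \int[Pr]_(w in A) (Z w)%:E)%E].

Definition cadlag X : Prop :=
  {ae Pr, forall w,
    (forall t, 0 <= t < T -> X s w @[s --> t^'+] --> X t w) /\
    (forall t, 0 < t <= T -> cvg (X s w @[s --> t^'-]))}.

(* The right limit [X_{t+}]; [lim] takes an arbitrary value where the limit
   does not exist. *)
Definition rlim X (t : R) (w : Omega) : R := lim (X s w @[s --> t^'+]).

Definition martingale M : Prop :=
  [/\ adapted M,
      forall t, 0 <= t <= T -> Pr.-integrable setT (EFin \o M t),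
      forall s t, 0 <= s -> s <= t -> t <= T -> is_condexp (F s) (M t) (M s)
    & cadlag M].

Definition uniformly_integrable (Y : set (Omega -> R)) : Prop :=
  (forall Z, Y Z -> measurable_fun setT Z) /\
  (forall e : R, 0 < e -> exists K : R, forall Z, Y Z ->
    (\int[Pr]_(w in [set w | (K < `|Z w|)%R]) `|Z w|%:E <= e%:E)%E).

Definition ui_martingale M : Prop :=
  martingale M /\ uniformly_integrable [set M t | t in `[0, T]].

Definition stopping_time (tau : Omega -> R) : Prop :=
  (forall w, 0 <= tau w <= T) /\
  (forall t, 0 <= t -> F t [set w | tau w <= t]).

Definition class_D X : Prop :=
  adapted X /\
  uniformly_integrable
    [set (fun w => X (tau w) w) | tau in [set tau | stopping_time tau]].

(* [(V, M)] solves
     V_t = xi - (M_T - M_t) + \sum_(t <= t_i < T) J_i,  t in [0, T],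
   with [V] of class (D) and [M] a uniformly integrable martingale started
   at 0.  In applications [J] itself depends on [V].  The equation is written
   in the extended reals because an entropy term of a density may be infinite;
   as its left-hand side is real, it forces the sum to be finite. *)
Definition bsde (N : nat) (tt : 'I_N.+1 -> R) (xi : Omega -> R)
    (J : 'I_N.+1 -> Omega -> \bar R) (V M : R -> Omega -> R) : Prop :=
  [/\ class_D V, ui_martingale M, {ae Pr, forall w, M 0 w = 0}
    & {ae Pr, forall w, forall t, 0 <= t <= T ->
        ((V t w)%:E = (xi w - (M T w - M t w))%:E +
           \sum_(i < N.+1 | (t <= tt i < T)%R) J i w)%E}].

End Processes.

Section Game.
Context {R : realType}.

Definition Psi (x : R) : R :=
  if x == 0 then 2^-1 else x^-1 * ln ((expR x - 1) / x).

Definition Phi (x : R) : R := x * Psi x.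

(* [ln 0 = 0] in the library, so that [0 * ln 0 = 0].  The integrands below have
   an integrable positive part when [pi] is a density on [0, 1], so the
   integrals lie in [-oo, +oo[. *)
Definition Gfun (lam p x : R) (pi : R -> R) : \bar R :=
  (\int[lebesgue_measure]_(u in `[0%R, 1%R])
     ((p - x) * u * pi u - lam * pi u * ln (pi u))%:E)%E.

Definition Hfun (lam r x : R) (pi : R -> R) : \bar R :=
  (\int[lebesgue_measure]_(u in `[0%R, 1%R])
     ((x - r) * u * pi u - lam * pi u * ln (pi u))%:E)%E.

Definition gibbs (a u : R) : R :=
  if a == 0 then 1 else a / (expR a - 1) * expR (a * u).

Definition pi_low (lam p x u : R) : R := gibbs (lam^-1 * (p - x)) u.

Definition pi_up (lam r x u : R) : R := gibbs (lam^-1 * (x - r)) u.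

Definition density01 (pi : R -> R) : Prop :=
  (forall u, 0 <= u <= 1 -> 0 <= pi u) /\
  (\int[lebesgue_measure]_(u in `[0%R, 1%R]) (pi u)%:E = 1)%E.

End Game.

Section Scheme.
Context {d : measure_display} {Omega : measurableType d} {R : realType}.
Variables (Pr : probability Omega R) (F : R -> set (set Omega)) (T : R).
Variables (N : nat) (tt : 'I_N.+1 -> R).

(* Policies: [pi i w u] is the density at [u] of the policy at time [t_i]. *)
Definition policy (pi : 'I_N.+1 -> Omega -> R -> R) : Prop :=
  forall i,
    (forall w, density01 (pi i w)) /\
    measurable_fun ([set: g_sigma_algebraType (F (tt i))] `*` `[0 : R, 1 : R])
      (fun z : g_sigma_algebraType (F (tt i)) * R => pi i z.1 z.2).

Variables (lam : R) (P Q : R -> Omega -> R).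

Definition regularised_value (V M : R -> Omega -> R) : Prop :=
  bsde Pr F T tt (P T)
    (fun i w =>
      (lam * Phi (lam^-1 * (P (tt i) w - rlim V (tt i) w)) -
       lam * Phi (lam^-1 * (rlim V (tt i) w - Q (tt i) w)))%:E) V M.

(* [V n] and [W n] stand for [V^{n,n}] and [V^{n,n+1}], [K n] and [L n] for the
   martingales [M^{n,n}] ([n > 0]) and [M^{n,n+1}]; [pl n] and [pu n] for the
   lower and upper policies (the maximisers of [Gfun] and [Hfun]) at step
   [n]. *)
Record policy_iteration (V K W L : nat -> R -> Omega -> R)
    (pl pu : nat -> 'I_N.+1 -> Omega -> R -> R) : Prop := PolicyIteration {
  pi_pl0 : policy (pl 0%N);
  pi_pu0 : policy (pu 0%N);
  pi_V0_cadlag : cadlag Pr T (V 0%N);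
  pi_V0 : forall t, 0 <= t <= T -> is_condexp Pr (F t) (P T) (V 0%N t);
  pi_step1 : forall n i, {ae Pr, forall w, forall u, 0 <= u <= 1 ->
    pu n.+1 i w u = pi_up lam (Q (tt i) w) (rlim (V n) (tt i) w) u};
  pi_step2 : forall n,
    bsde Pr F T tt (P T)
      (fun i w =>
        (Gfun lam (P (tt i) w) (rlim (V n) (tt i) w) (pl n i w) -
         Hfun lam (Q (tt i) w) (rlim (W n) (tt i) w) (pu n.+1 i w))%E)
      (W n) (L n);
  pi_step3 : forall n i, {ae Pr, forall w, forall u, 0 <= u <= 1 ->
    pl n.+1 i w u = pi_low lam (P (tt i) w) (rlim (W n) (tt i) w) u};
  pi_step4 : forall n,
    bsde Pr F T tt (P T)
      (fun i w =>
        (Gfun lam (P (tt i) w) (rlim (V n.+1) (tt i) w) (pl n.+1 i w) -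
         Hfun lam (Q (tt i) w) (rlim (W n) (tt i) w) (pu n.+1 i w))%E)
      (V n.+1) (K n.+1) }.

(* [N(t+) = (N + 1) - max {i : t_i <= t}] *)
Definition Nplus (t : R) : nat :=
  (N.+1 - \max_(i < N.+1 | (tt i <= t)%R) i)%N.

End Scheme.

(* Main.v *)
Require Import Defs.
From mathcomp Require Import all_boot all_order all_algebra.
From mathcomp Require Import all_classical all_reals all_analysis.
From mathcomp Require Import measurable_realfun ring.
Import Order.TTheory GRing.Theory Num.Theory.
Import numFieldNormedType.Exports.
Local Open Scope classical_set_scope.
Local Open Scope ring_scope.
Set Implicit Arguments.
Unset Strict Implicit.
Unset Printing Implicit Defensive.

(** Between two consecutive exercise dates every process of the scheme is
    [P_T] minus a martingale increment, plus the jumps at the later dates.  If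
    two such processes have almost surely the same jumps at all dates [t_i >= s],
    then at time [s] their difference is an [F_s]-measurable random variable equal
    to a martingale increment from [s] to [T]; its integral over every event of
    [F_s] vanishes, so it is zero ([weak_solution_unique_at]).  Letting [s]
    decrease to [t_j], equality of the jumps strictly after [t_j] already gives
    equality of the right limits at [t_j] ([weak_solution_unique_rlim]).

    On the other hand [V^lambda] is a fixed point of the scheme: the entropy
    functional evaluated at its own maximiser, a truncated exponential density, is
    [lambda * Phi] ([optimal_jump]).  Hence as soon as the right limits at [t_i] of
    the three processes that enter the jump of the new iterate at [t_i] coincide
    with that of [V^lambda], this jump is the jump of [V^lambda].

    The two facts combine into a backward induction, in which each iteration
    gains one exercise date: after [m] iterations the right limits at the last
    [m + 1] dates are those of [V^lambda].  After [t_N] there is no jump, so the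
    case [m = 0] holds for every process of the scheme, including [V^{0,0}],
    which is itself such a process, with no jumps and martingale part [V^{0,0}]
    ([condexp_weak_solution]).  At time [t] only the dates [t_i >= t] count, which
    yields the bound [N(t+)]. *)

(** * Martingales and conditional expectations *)

Section WeakSolutions.
Context {d : measure_display} {Omega : measurableType d} {R : realType}.
Variables (Pr : probability Omega R).

Lemma measurable_wrtW (G : set (set Omega)) (Y : Omega -> R) :
  G `<=` measurable -> measurable_wrt G Y -> measurable_fun setT Y.
Proof. by move=> GM mY _ B mB; rewrite setTI; apply: GM; exact: mY. Qed.

Lemma measurable_wrtB (G : set (set Omega)) (Y Z : Omega -> R) :
  sigma_algebra setT G -> measurable_wrt G Y -> measurable_wrt G Z ->
  measurable_wrt G (fun w => Y w - Z w).
Proof.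
move=> sG mY mZ.
have E (X : Omega -> R) : measurable_wrt G X <->
    measurable_fun [set: g_sigma_algebraType G] (X : g_sigma_algebraType G -> R).
  split=> [mX _ B mB|mX B mB].
    by rewrite setTI; apply: sub_sigma_algebra; exact: mX.
  have := mX measurableT B mB; rewrite setTI.
  by rewrite /measurable /= sigma_algebra_id.
by apply/E; apply: measurable_funB; exact/E.
Qed.

Lemma ae_ge0_integrable (Y : Omega -> R) : measurable_fun setT Y ->
  {ae Pr, forall w, 0 <= Y w} -> ('E_Pr[Y] < +oo)%E ->
  Pr.-integrable setT (EFin \o Y).
Proof.
move=> mY Y0 EY; apply/integrableP; split; first exact/measurable_EFinP.
rewrite unlock in EY; apply: le_lt_trans EY.
rewrite (ae_eq_integral (EFin \o Y))//.
- by apply: measurableT_comp => //; exact/measurable_EFinP.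
- exact/measurable_EFinP.
- by apply: filterS Y0 => w Yw _; rewrite /= ger0_norm.
Qed.

(** Uniqueness of the conditional expectation.  Here [Y] is [G]-measurable while
    [U] need not be; testing against the events [Y >= 0] and [Y < 0], which lie in
    [G], gives a vanishing integral of [|Y|]. *)
Lemma ae_eq0_of_integrals (G : set (set Omega)) (Y U : Omega -> R) :
  sigma_algebra setT G -> G `<=` measurable -> measurable_wrt G Y ->
  measurable_fun setT U -> {ae Pr, forall w, Y w = U w} ->
  (forall A, G A -> \int[Pr]_(w in A) (U w)%:E = 0)%E ->
  {ae Pr, forall w, Y w = 0}.
Proof.
move=> sG GM mY mU YU U0; have mY' := measurable_wrtW GM mY.
have Y0 A : G A -> (\int[Pr]_(w in A) (Y w)%:E = 0)%E.
  move=> GA; rewrite -(U0 _ GA); apply: ae_eq_integral.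
  - exact: GM.
  - by apply/measurable_EFinP; apply: measurable_funS mY'.
  - by apply/measurable_EFinP; apply: measurable_funS mU.
  - by apply: filterS YU => w /= -> .
pose A := Y @^-1` `[0, +oo[%classic; pose B := Y @^-1` `]-oo, 0[%classic.
have GA : G A by apply: mY; exact: measurable_itv.
have GB : G B by apply: mY; exact: measurable_itv.
have AB : A `|` B = setT.
  apply/seteqP; split => // w _; rewrite /A /B /= !in_itv/= andbT.
  by case: (leP 0 (Y w)); [left|right].
have : (\int[Pr]_(w in setT) `|(Y w)%:E| = 0)%E.
  rewrite -AB ge0_integral_setU//=.
  - rewrite (_ : (\int[Pr]_(w in A) _ = 0)%E); last first.
      rewrite -(Y0 _ GA); apply: eq_integral => w; rewrite inE /A/= in_itv/= andbT.
      by move=> Yw; rewrite ger0_norm.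
    rewrite add0e; apply: oppe_inj; rewrite oppe0 -(Y0 _ GB) -integral_ge0N//.
    apply: eq_integral => w; rewrite inE /B/= in_itv/= => Yw.
    by rewrite ltr0_norm// opprK.
  - exact: GM.
  - exact: GM.
  - by rewrite AB; apply/measurable_EFinP; apply: measurableT_comp.
  - rewrite disj_set2E; apply/eqP/seteqP; split => // w [].
    by rewrite /A /B/= !in_itv/= andbT => Yw /(le_lt_trans Yw); rewrite ltxx.
have mY'' : measurable_fun setT (EFin \o Y) by exact/measurable_EFinP.
move=> h; have/(ae_eq_integral_abs _ measurableT mY'') := h.
by apply: filterS => w /= /(_ Logic.I) [].
Qed.

(** * Solutions of the equation and their uniqueness *)

Variables (F : R -> set (set Omega)) (T : R).
Hypothesis hF : filtration_usual Pr F.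
Variables (N : nat) (tt : 'I_N.+1 -> R) (xi : Omega -> R).

(** A form of [bsde] that also covers [V^{0,0}], whose martingale part is
    [V^{0,0}] itself and so does not start at 0. *)
Definition weak_solution (J : 'I_N.+1 -> Omega -> \bar R)
    (V M : R -> Omega -> R) : Prop :=
  [/\ adapted F T V, martingale Pr F T M
    & {ae Pr, forall w, forall t, 0 <= t <= T ->
        ((V t w)%:E = (xi w - (M T w - M t w))%:E +
           \sum_(i < N.+1 | (t <= tt i < T)%R) J i w)%E}].

Lemma bsde_weak_solution J V M : bsde Pr F T tt xi J V M -> weak_solution J V M.
Proof. by case=> [[aV _] [mM _] _ eqV]. Qed.

Lemma integral_martingale_increment (M : R -> Omega -> R) s A :
  martingale Pr F T M -> 0 <= s <= T -> F s A ->
  (\int[Pr]_(w in A) (M T w - M s w)%:E = 0)%E.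
Proof.
move=> [_ iM cM _] /andP[s0 sT] FA.
have mA : measurable A by exact: (filtration_sub hF s0).
have T0 := le_trans s0 sT.
have iA r : 0 <= r <= T -> Pr.-integrable A (EFin \o M r).
  by move=> hr; apply: integrableS (iM _ hr).
under eq_integral do rewrite EFinB.
rewrite integralB_EFin//; [|by apply: iA; rewrite T0 lexx|by apply: iA; rewrite s0].
have [_ _ /(_ _ FA) ->] := cM _ _ s0 sT (lexx T).
rewrite subee// integrable_fin_num//.
by apply: iA; rewrite T0 lexx.
Qed.

(** The jumps cancel in the difference [V s - V' s], which becomes a martingale
    increment from [s] to [T] that is at the same time [F s]-measurable. *)
Lemma weak_solution_unique_at J J' V V' M M' s :
  weak_solution J V M -> weak_solution J' V' M' -> 0 <= s <= T ->
  (forall i, s <= tt i -> {ae Pr, forall w, J i w = J' i w}) ->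
  {ae Pr, forall w, V s w = V' s w}.
Proof.
move=> [aV mM eV] [aV' mM' eV'] hs JJ'; have /andP[s0 sT] := hs.
have JJ : {ae Pr, forall w, forall i, s <= tt i -> J i w = J' i w}.
  apply: filter_forall => i; have [si|si] := boolP (s <= tt i).
    by apply: filterS (JJ' _ si).
  by apply: nearW => w.
pose U w := (M' T w - M' s w) - (M T w - M s w).
have VU : {ae Pr, forall w, V s w - V' s w = U w}.
  apply: filterS3 JJ eV eV' => w JJw /(_ _ hs) + /(_ _ hs).
  rewrite (eq_bigr (fun i => J' i w)); last by move=> i /andP[/JJw].
  (* The common sum of jumps is finite because the left-hand sides are. *)
  case: (X in (_ + X)%E) => [r| |] //.
  by rewrite -!EFinD => -[->] [->]; rewrite /U; ring.
have iM m r : martingale Pr F T m -> 0 <= r <= T -> Pr.-integrable setT (EFin \o m r).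
  by case=> _ im _ _; exact: im.
have hT : 0 <= T <= T by rewrite lexx (le_trans s0).
have mMr m r : martingale Pr F T m -> 0 <= r <= T -> measurable_fun setT (m r).
  by move=> hm hr; apply/measurable_EFinP/(measurable_int Pr)/iM.
have V0 : {ae Pr, forall w, V s w - V' s w = 0}.
  apply: (ae_eq0_of_integrals (filtration_sigma hF s0) (filtration_sub hF s0) _ _ VU).
  - apply: measurable_wrtB; [exact: (filtration_sigma hF s0)|exact: aV|exact: aV'].
  - by apply: measurable_funB; apply: measurable_funB; exact: mMr.
  - move=> A FA; have mA := filtration_sub hF s0 FA.
    under eq_integral do rewrite /U EFinB.
    have inc m : martingale Pr F T m ->
        Pr.-integrable A (EFin \o (fun w => m T w - m s w)).
      move=> hm; apply: (integrableS measurableT) => //.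
      by apply: (integrableB _ (iM _ _ hm hT) (iM _ _ hm hs)).
    rewrite integralB_EFin//; [|exact: inc|exact: inc].
    by rewrite !integral_martingale_increment// subee.
by apply: filterS V0 => w /eqP; rewrite subr_eq0 => /eqP.
Qed.

(** Immediately to the right of [a] the sum of jumps is constant, so [V] inherits
    the right limit of its martingale part. *)
Lemma weak_solution_cvg_right J V M a : weak_solution J V M -> 0 <= a < T ->
  {ae Pr, forall w, cvg (V s w @[s --> a^'+])}.
Proof.
move=> [_ [_ _ _ rcM] eqV] /andP[a0 aT].
apply: filterS2 rcM eqV => w [/(_ a) + _] eqV; rewrite a0 aT => /(_ isT) Ma.
pose S := (\sum_(i < N.+1 | (a < tt i < T)%R) J i w)%E.
have VS : \forall s \near a^'+,
    ((V s w)%:E = (xi w - (M T w - M s w))%:E + S)%E.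
  have sta : \forall s \near a^'+, forall i, (s <= tt i) = (a < tt i).
    apply: filter_forall => i; have [ai|ia] := ltP a (tt i).
      by near=> s; apply/ltW; near: s; exact: nbhs_right_lt.
    near=> s; apply/negbTE; rewrite -ltNge; apply: le_lt_trans ia _.
    by near: s; exact: nbhs_right_gt.
  near=> s; rewrite eqV.
    congr (_ + _)%E; apply: eq_bigl => i; congr (_ && _).
    by move: i; near: s.
  apply/andP; split; first by apply: le_trans a0 _; near: s; exact: nbhs_right_ge.
  by near: s; exact: nbhs_right_le.
(* An infinite sum of jumps would contradict the equation at a nearby time. *)
case: S VS => [r| |] VS; last 2 first.
- by case: (@filter_ex _ (a^'+) _ _ VS).
- by case: (@filter_ex _ (a^'+) _ _ VS).
apply/cvg_ex; exists (xi w - (M T w - M a w) + r).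
have : xi w - (M T w - M s w) + r @[s --> a^'+] --> xi w - (M T w - M a w) + r.
  apply: cvgD; last exact: cvg_cst.
  by apply: cvgB; [exact: cvg_cst|apply: cvgB => //; exact: cvg_cst].
apply: cvg_trans; apply: near_eq_cvg.
by apply: filterS VS => s; rewrite -EFinD => -[->].
Unshelve. all: by end_near. Qed.

(** [weak_solution_unique_at] gives a null set for each time; a sequence of times
    decreasing to [a] needs only countably many of them, and both right limits
    can be read off along it. *)
Lemma weak_solution_unique_rlim J J' V V' M M' a :
  weak_solution J V M -> weak_solution J' V' M' -> 0 <= a < T ->
  (forall i, a < tt i -> {ae Pr, forall w, J i w = J' i w}) ->
  {ae Pr, forall w, rlim V a w = rlim V' a w}.
Proof.
move=> sol sol' ha JJ'; have /andP[a0 aT] := ha.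
pose u n := a + (T - a) * n.+1%:R^-1.
have u_gt n : a < u n by rewrite ltrDl mulr_gt0 ?subr_gt0// invr_gt0.
have u_le n : u n <= T.
  rewrite /u -lerBrDl ler_piMr ?subr_ge0 ?(ltW aT)//.
  by rewrite invf_le1// ler1n.
have u_cvg : u n @[n --> \oo] --> a.
  rewrite -[X in _ --> X]addr0 -[X in _ + X](mulr0 (T - a)).
  apply: cvgD; first exact: cvg_cst.
  by apply: cvgM; [exact: cvg_cst|exact: cvg_harmonic].
have VV' : {ae Pr, forall w, forall n, V (u n) w = V' (u n) w}.
  apply: ae_foralln => n; apply: (weak_solution_unique_at sol sol').
    by rewrite u_le (le_trans a0 (ltW (u_gt n))).
  by move=> i ui; apply: JJ'; exact: lt_le_trans ui.
have cV := weak_solution_cvg_right sol ha.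
have cV' := weak_solution_cvg_right sol' ha.
apply: filterS3 VV' cV cV' => w VV'w.
move=> /cvg_at_rightP/(_ u (conj u_gt u_cvg)) Vu.
move=> /cvg_at_rightP/(_ u (conj u_gt u_cvg)) V'u.
apply: (cvg_unique _ Vu); first exact: Rhausdorff.
rewrite /=; under eq_cvg do rewrite VV'w.
exact: V'u.
Qed.

(** A closed martingale solves the equation without jumps; the terminal condition
    [V T = xi] holds since [xi] is [F T]-measurable. *)
Lemma condexp_weak_solution V : 0 < T -> measurable_wrt (F T) xi ->
  Pr.-integrable setT (EFin \o xi) -> cadlag Pr T V ->
  (forall t, 0 <= t <= T -> is_condexp Pr (F t) xi (V t)) ->
  weak_solution (fun _ _ => 0%E) V V.
Proof.
move=> T0 mxi ixi cV ceV.
have hT : 0 <= T <= T by rewrite lexx ltW.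
have FTm := filtration_sub hF (ltW T0).
split.
- by move=> t ht; case: (ceV t ht).
- split=> // [t ht|t ht|s t s0 st tT]; [by case: (ceV t ht)..|].
  have [ms iS es] := ceV s ltac:(by rewrite s0 (le_trans st)).
  have [_ _ et] := ceV t ltac:(by rewrite tT (le_trans s0)).
  split=> // A FA; rewrite es// et//.
  exact: (filtration_mono hF s0 st).
have VT : {ae Pr, forall w, V T w - xi w = 0}.
  have [mVT iVT eVT] := ceV _ hT.
  apply: (@ae_eq0_of_integrals (F T) _ (fun w => V T w - xi w)) => //.
  - exact: (filtration_sigma hF (ltW T0)).
  - by apply: measurable_wrtB => //; exact: (filtration_sigma hF (ltW T0)).
  - by apply: measurable_funB; exact: measurable_wrtW FTm _.
  - exact: nearW.
  - move=> A FA; have mA := FTm _ FA.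
    under eq_integral do rewrite EFinB.
    have iA f : Pr.-integrable setT f -> Pr.-integrable A f.
      by move=> hf; exact: (integrableS measurableT).
    rewrite integralB_EFin//; [|exact: iA|exact: iA].
    by rewrite eVT// subee// integrable_fin_num//; exact: iA.
apply: filterS VT => w /eqP; rewrite subr_eq0 => /eqP -> t _.
by rewrite big1// adde0 subKr.
Qed.

End WeakSolutions.
(** * The entropy functional at its maximiser *)

Section Gibbs.
Context {R : realType}.

Lemma gibbs_coef_gt0 (a : R) : a != 0 -> 0 < a / (expR a - 1).
Proof.
move=> a0; have [ap|an|a00] := ltgtP 0 a; last by rewrite -a00 eqxx in a0.
- by rewrite divr_gt0 ?subr_gt0 ?expR_gt1.
- by rewrite -mulrNN -invrN mulr_gt0 ?invr_gt0 ?oppr_gt0 ?subr_lt0 ?expR_lt1.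
Qed.

Lemma continuous_gibbs (a : R) : continuous (gibbs a).
Proof.
rewrite /gibbs; have [_|a0] := eqVneq a 0; first by move=> x; exact: cvg_cst.
move=> x; apply: cvgM; first exact: cvg_cst.
apply: continuous_comp; last exact: continuous_expR.
by apply: cvgM; [exact: cvg_cst|exact: cvg_id].
Qed.

Lemma integrable_gibbs (a : R) :
  lebesgue_measure.-integrable `[0%R, 1%R] (EFin \o gibbs a).
Proof.
apply: continuous_compact_integrable; first exact: segment_compact.
by apply: continuous_subspaceT; exact: continuous_gibbs.
Qed.

Lemma integral_gibbs (a : R) :
  (\int[lebesgue_measure]_(u in `[0%R, 1%R]) (gibbs a u)%:E = 1)%E.
Proof.
rewrite /gibbs; have [_|a0] := eqVneq a 0.
  by rewrite integral_cst//= mul1e lebesgue_measure_itv/= lte_fin ltr01 oppr0 adde0.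
pose F (u : R) : R := (expR a - 1)^-1 * expR (a * u).
have dF (x : R) : is_derive x 1 F (a / (expR a - 1) * expR (a * x)).
  rewrite /F; apply: is_derive_eq.
  rewrite /GRing.scale/= mulr1; ring.
have cF : continuous F.
  by move=> x; apply/differentiable_continuous/derivable1_diffP; case: (dF x).
have ea1 : expR a != 1 by rewrite -expR0; apply: contra_neq a0 => /expR_inj.
have cg : {within `[0, 1], continuous (fun u => a / (expR a - 1) * expR (a * u))}.
  apply: continuous_subspaceT => x.
  by have := @continuous_gibbs a x; rewrite /gibbs (negbTE a0).
rewrite (@continuous_FTC2 _ _ F)//.
- by rewrite -EFinB /F mulr1 mulr0 expR0 -mulrBr mulVf// subr_eq0.
- split => [x _||]; first by case: (dF x).
  + exact/cvg_at_right_filter/cF.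
  + exact/cvg_at_left_filter/cF.
- by move=> x _; rewrite derive1E; apply: derive_val.
Qed.

Lemma Phi_gibbs (a : R) :
  Phi a = if a == 0 then 0 else - ln (a / (expR a - 1)).
Proof.
rewrite /Phi /Psi; have [->|a0] := eqVneq a 0; first by rewrite mul0r.
rewrite mulrA divff// mul1r -[X in - ln X]invf_div lnV ?opprK//.
by rewrite posrE -invf_div invr_gt0 gibbs_coef_gt0.
Qed.

(** Since [ln (gibbs a u) = ln c + a * u], with [c] the normalising constant, the
    linear reward cancels and the integrand is [- lam * ln c] times a density;
    and [- ln c] is [Phi a]. *)
Lemma gibbs_value (lam a : R) :
  (\int[lebesgue_measure]_(u in `[0%R, 1%R])
     (lam * a * u * gibbs a u - lam * gibbs a u * ln (gibbs a u))%:E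
   = (lam * Phi a)%:E)%E.
Proof.
rewrite Phi_gibbs; case: ifPn => [/eqP ->|a0].
  rewrite mulr0; apply: integral0_eq => u _.
  by rewrite /gibbs eqxx ln1 !mulr0 !mul0r subr0.
have c0 := gibbs_coef_gt0 a0.
under eq_integral => u _.
  have -> : lam * a * u * gibbs a u - lam * gibbs a u * ln (gibbs a u)
      = lam * - ln (a / (expR a - 1)) * gibbs a u.
    rewrite /gibbs (negbTE a0) [ln (_ * expR _)]lnM ?posrE ?expR_gt0// expRK.
    by ring.
  rewrite EFinM; over.
rewrite integralZl//; first by rewrite integral_gibbs mule1.
exact: integrable_gibbs.
Qed.

Lemma Gfun_pi_low (lam p x : R) (pi : R -> R) : 0 < lam ->
  (forall u, 0 <= u <= 1 -> pi u = pi_low lam p x u) ->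
  Gfun lam p x pi = (lam * Phi (lam^-1 * (p - x)))%:E.
Proof.
move=> l0 piE; rewrite -gibbs_value; apply: eq_integral => u.
rewrite inE/= in_itv/= => /piE ->; rewrite /pi_low mulrA divff ?mul1r//.
exact: lt0r_neq0.
Qed.

(** The jump of the scheme when the policies are optimal for the very value [v] at
    which the rewards are evaluated is the jump of the regularised value. *)
Lemma optimal_jump (lam p r v : R) (pl pu : R -> R) : 0 < lam ->
  (forall u, 0 <= u <= 1 -> pl u = pi_low lam p v u) ->
  (forall u, 0 <= u <= 1 -> pu u = pi_up lam r v u) ->
  (Gfun lam p v pl - Hfun lam r v pu =
    (lam * Phi (lam^-1 * (p - v)) - lam * Phi (lam^-1 * (v - r)))%:E)%E.
Proof.
move=> l0 plE puE; rewrite EFinB; congr (_ - _)%E; first exact: Gfun_pi_low.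
(* [Hfun lam r v] is [Gfun lam v r], and likewise for the maximisers. *)
exact: (@Gfun_pi_low lam v r).
Qed.
End Gibbs.

(** * Convergence of the scheme *)

Theorem theorem4p3 (d : measure_display) (Omega : measurableType d)
    (R : realType) (Pr : probability Omega R)
    (F : R -> set (set Omega)) (hF : filtration_usual Pr F)
    (T : R) (hT : 0 < T)
    (N : nat) (tt : 'I_N.+1 -> R)
    (htt0 : tt ord0 = 0)
    (htt_lt : forall i j : 'I_N.+1, (i < j)%N -> tt i < tt j)
    (httT : forall i, tt i < T)
    (P Q : R -> Omega -> R)
    (hP : adapted F T P) (hQ : adapted F T Q)
    (hP0 : forall s : R, 0 <= s <= T -> {ae Pr, forall w, 0 <= P s w})
    (hPQ : forall i, {ae Pr, forall w, P (tt i) w < Q (tt i) w})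
    (hPQT : {ae Pr, forall w, Q T w = P T w})
    (hPint : forall u, range tt u \/ u = T -> ('E_Pr[P u] < +oo)%E)
    (hQint : forall u, range tt u \/ u = T -> ('E_Pr[Q u] < +oo)%E)
    (lam : R) (hlam : 0 < lam)
    (Vlam Mlam : R -> Omega -> R)
    (hVlam : regularised_value Pr F T tt lam P Q Vlam Mlam)
    (V K W L : nat -> R -> Omega -> R)
    (pl pu : nat -> 'I_N.+1 -> Omega -> R -> R)
    (hPI : policy_iteration Pr F T tt lam P Q V K W L pl pu)
    (t : R) (ht : 0 <= t < T) :
  {ae Pr, forall w, forall n, (Nplus tt t <= n)%N -> V n t w = Vlam t w}.
Proof.
have mPT : measurable_wrt (F T) (P T) by apply: hP; rewrite lexx ltW.
have FTm := filtration_sub hF (ltW hT).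
have iPT : Pr.-integrable setT (EFin \o P T).
  apply: ae_ge0_integrable; first exact: measurable_wrtW FTm mPT.
    by apply: hP0; rewrite lexx ltW.
  by apply: hPint; right.
pose weak := weak_solution Pr F T tt (P T).
pose J n i w := (Gfun lam (P (tt i) w) (rlim (V n.+1) (tt i) w) (pl n.+1 i w) -
  Hfun lam (Q (tt i) w) (rlim (W n) (tt i) w) (pu n.+1 i w))%E.
have solVS n : weak (J n) (V n.+1) (K n.+1).
  exact/bsde_weak_solution/(pi_step4 hPI).
have solV n : exists Jn Mn, weak Jn (V n) Mn.
  case: n => [|n]; last by exists (J n), (K n.+1).
  exists (fun _ _ => 0%E), (V 0%N).
  apply: condexp_weak_solution => //; [exact: (pi_V0_cadlag hPI)|exact: (pi_V0 hPI)].
have solW n := bsde_weak_solution (pi_step2 hPI n).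
have sol := bsde_weak_solution hVlam.
have tt_ge0 i : 0 <= tt i < T.
  rewrite httT andbT -htt0; have [->//|i0] := eqVneq i ord0.
  by apply/ltW/htt_lt; rewrite lt0n.
have tt_lt i j : tt i < tt j -> (i < j)%N.
  by apply: contraTT; rewrite -leqNgt -leNgt leq_eqVlt => /predU1P[/val_inj->//|/htt_lt/ltW].
(* [agree m X]: the right limits of [X] and [Vlam] agree at the last [m + 1]
   dates. *)
pose agree m X := forall j : 'I_N.+1, (N <= j + m)%N ->
  {ae Pr, forall w, rlim X (tt j) w = rlim Vlam (tt j) w}.
pose Jlam i w := (lam * Phi (lam^-1 * (P (tt i) w - rlim Vlam (tt i) w)) -
  lam * Phi (lam^-1 * (rlim Vlam (tt i) w - Q (tt i) w)))%:E.
(* The lower policy of [V n.+1] was computed from [W n] and the upper one from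
   [V n], hence the three assumptions. *)
have jumpV m n (i : 'I_N.+1) : (N <= i + m)%N ->
    agree m (V n) -> agree m (W n) -> agree m (V n.+1) ->
    {ae Pr, forall w, J n i w = Jlam i w}.
  move=> im /(_ _ im) Vn /(_ _ im) Wn /(_ _ im) VSn.
  apply: filter_app (pi_step3 hPI n i); apply: filter_app (pi_step1 hPI n i).
  apply: filterS3 Vn Wn VSn => w Vw Ww VSw puw plw.
  rewrite /J VSw Ww; rewrite Vw in puw; rewrite Ww in plw.
  exact: optimal_jump.
have jumpW m n (i : 'I_N.+1) : (N <= i + m)%N ->
    agree m (W n) -> agree m (V n.+1) -> agree m (W n.+1) ->
    {ae Pr, forall w,
      (Gfun lam (P (tt i) w) (rlim (V n.+1) (tt i) w) (pl n.+1 i w) -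
       Hfun lam (Q (tt i) w) (rlim (W n.+1) (tt i) w) (pu n.+2 i w))%E
      = Jlam i w}.
  move=> im /(_ _ im) Wn /(_ _ im) VSn /(_ _ im) WSn.
  apply: filter_app (pi_step3 hPI n i); apply: filter_app (pi_step1 hPI n.+1 i).
  apply: filterS3 Wn VSn WSn => w Ww VSw WSw puw plw.
  rewrite VSw WSw; rewrite VSw in puw; rewrite Ww in plw.
  exact: optimal_jump.
(* One more date per iteration: the jumps after [t_j] only involve dates at which
   agreement is known for this iterate and the previous one. *)
have agreeVW m n : (m <= n)%N -> agree m (V n) /\ agree m (W n).
  elim: m n => [n _|m IH [//|n] mn].
    have noJ (j i : 'I_N.+1) : (N <= j + 0)%N -> ~ tt j < tt i.
      rewrite addn0 => Nj /tt_lt ji.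
      by have := leq_trans ji (ltn_ord i : (i <= N)%N); rewrite ltnNge Nj.
    have [Jn [Mn solVn]] := solV n.
    split=> j Nj; [apply: (weak_solution_unique_rlim hF solVn sol (tt_ge0 j))
      |apply: (weak_solution_unique_rlim hF (solW n) sol (tt_ge0 j))];
      by move=> i /(noJ _ _ Nj).
  have [Vn Wn] := IH n mn; have [VSn WSn] := IH n.+1 (leqW mn).
  have im (i j : 'I_N.+1) : (N <= j + m.+1)%N -> tt j < tt i -> (N <= i + m)%N.
    by move=> Nj /tt_lt ji; rewrite (leq_trans Nj)// addnS -addSn leq_add2r.
  split=> j Nj.
    apply: (weak_solution_unique_rlim hF (solVS n) sol (tt_ge0 j)) => i.
    by move=> /(im _ _ Nj) Ni; exact: jumpV Ni Vn Wn VSn.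
  apply: (weak_solution_unique_rlim hF (solW n.+1) sol (tt_ge0 j)) => i.
  by move=> /(im _ _ Nj) Ni; exact: jumpW Ni Wn VSn WSn.
apply: ae_foralln => n.
have [Nn|_] := leqP (Nplus tt t) n; last exact: nearW.
have max_le (i : 'I_N.+1) : t <= tt i ->
    (\max_(j < N.+1 | (tt j <= t)%R) j <= i)%N.
  move=> ti; apply/bigmax_leqP => j jt; rewrite leqNgt; apply/negP => /htt_lt.
  by rewrite ltNge (le_trans jt ti).
(* [N(t+)] is positive, so that [V n] comes from the equation of the scheme. *)
case: n Nn => [|n] Nn.
  move: Nn; rewrite leqn0 subn_eq0 ltnNge.
  by move/negP; case; apply/bigmax_leqP => j _; rewrite -ltnS.
have [Vn Wn] := agreeVW n n (leqnn n).
have [VSn _] := agreeVW n n.+1 (leqnSn n).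
have hmain : {ae Pr, forall w, V n.+1 t w = Vlam t w}.
  apply: (weak_solution_unique_at hF (solVS n) sol).
    by case/andP: ht => -> /ltW ->.
  move=> i /max_le ti; apply: (jumpV n) => //.
  by move: Nn; rewrite leq_subLR addnS ltnS => /leq_trans; apply; rewrite leq_add2r.
by apply: filterS hmain.
Qed.
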